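(* Let $\xi,\Delta:\{t_0,t_0+1,\dots\}\to\mathbb R^+$ be such that $\Delta$ and $t\mapsto\xi_t\Delta_t$ are non-increasing and $\xi$ is non-decreasing. Let $\alpha>0$, $T\in\mathbb R$, let $D=\{D_t\}_{t\ge t_0}$ be a database stream and $F=\{\{f_{t,i}\}_{i=1}^{\ell_t}\}_{t_0\le t\le t'}$ a finite query stream with sensitivity $\Delta_{f_{t,i}}\le\Delta_t$ for all $(t,i)$, such that $f_{t,i}(D_t)<T-\alpha$ for all $(t,i)\ne(t',\ell_{t'})$ and $f_{t',\ell_{t'}}(D_{t'})\ge T+\alpha$. If $$\beta\ge\sum_{t=t_0}^{t'}\ell_t\exp\!\Big(-\frac{\alpha\xi_t}{8}\Big)+\exp\!\Big(-\frac{\alpha\xi_{t_0}}{8}\Big)+\exp\!\Big(-\frac{\alpha\xi_{t'}}{8}\Big),$$ then with probability at least $1-\beta$, $\mathrm{NATG}(D,F,T,\xi)$ does not halt before receiving the final query $f_{t',\ell_{t'}}$, every numeric answer $a_{t,i}\in\mathbb R$ satisfies $|f_{t,i}(D_t)-a_{t,i}|\le\alpha$ and $f_{t,i}(D_t)\ge T-\alpha$, and every answer $a_{t,i}=\bot$ satisfies $f_{t,i}(D_t)\le T+\alpha$.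
   Context: A database stream $D=\{D_t\}_{t\ge t_0}$ consists of databases $D_t$ of size $t$ over a finite universe, with $D_{t+1}$ obtained from $D_t$ by adding one entry. Query $f_{t,i}$ is a real-valued function on databases, arriving when the database has size $t$; its sensitivity $\Delta_{f_{t,i}}$ is $\max|f_{t,i}(E)-f_{t,i}(E')|$ over databases $E,E'$ of size $t$ differing in one entry. $\mathrm{Lap}(b)$ has density $\frac1{2b}e^{-|z|/b}$. $\mathrm{NATG}(D,F,T,\xi)$: draw $\eta\sim\mathrm{Lap}(2)$ once. For each incoming query $f_{t,i}$: draw fresh $\nu_{t,i}\sim\mathrm{Lap}(4/\xi_t)$; if $f_{t,i}(D_t)+\nu_{t,i}\ge T+\eta/\xi_t$, output $a_{t,i}=f_{t,i}(D_t)+Z$ with fresh $Z\sim\mathrm{Lap}(8/\xi_t)$ and halt; otherwise output $a_{t,i}=\bot$. *)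

(* Defs.v *)
From HB Require Import structures.
From mathcomp Require Import all_boot all_order all_algebra finmap.
From mathcomp Require Import all_classical all_reals all_analysis.

Set Implicit Arguments.
Unset Strict Implicit.
Unset Printing Implicit Defensive.

Import Order.TTheory GRing.Theory Num.Theory.
Import numFieldNormedType.Exports.

Local Open Scope classical_set_scope.
Local Open Scope ring_scope.

Section databases.
Context {R : realType} {U : finType}.

(* Databases are finite sequences over [U]. A query on unordered databases is
   a permutation-invariant function of such sequences. *)
Definition database_stream (t0 : nat) (D : nat -> seq U) : Prop :=
  forall t, (t0 <= t)%N ->
    size (D t) = t /\ exists u, D t.+1 = rcons (D t) u.

Definition neighbours (t : nat) (E E' : t.-tuple U) : bool :=
  #|[set k : 'I_t | tnth E k != tnth E' k]%SET| == 1%N.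

(* The default value 0 is only reached when there are no neighbours
   (t = 0 or #|U| <= 1). *)
Definition sensitivity (t : nat) (g : seq U -> R) : R :=
  \big[Num.max/0]_(p : t.-tuple U * t.-tuple U | neighbours p.1 p.2)
    `|g p.1 - g p.2|.

End databases.

(* Arrival order of the queries f_{t,i}, t0 <= t <= t', 1 <= i <= ell t. *)
Definition query_indices (t0 t' : nat) (ell : nat -> nat) : seq (nat * nat) :=
  [seq (t, i) | t <- index_iota t0 t'.+1, i <- index_iota 1 (ell t).+1].

(* [f t i] is the query f_{t,i}; [eta], [nu t i] and [Z t i] are the values of
   the noise. The result is the transcript of answers a_{t,i}, each tagged with
   its index (t, i), with [None] for bottom; queries arriving after halting do
   not appear in it. *)
Fixpoint NATG {R : realType} {U : finType} (D : nat -> seq U)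
    (f : nat -> nat -> seq U -> R) (T : R) (xi : nat -> R)
    (eta : R) (nu Z : nat -> nat -> R) (qs : seq (nat * nat)) :
    seq ((nat * nat) * option R) :=
  if qs is (t, i) :: qs' then
    if T + eta / xi t <= f t i (D t) + nu t i
    then [:: ((t, i), Some (f t i (D t) + Z t i))]
    else ((t, i), None) :: NATG D f T xi eta nu Z qs'
  else [::].

Section probability.
Context {R : realType} {d : measure_display} {Om : measurableType d}.
Variable P : probability Om R.

Definition laplace_pdf (b z : R) : R := (2 * b)^-1 * expR (- (`|z| / b)).

Definition laplace (b : R) (X : {RV P >-> R}) : Prop :=
  forall A : set R, measurable A ->
    distribution P X A = (\int[lebesgue_measure]_(z in A) (laplace_pdf b z)%:E)%E.

Definition mutually_independent (I : choiceType) (J : set I)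
    (X : I -> {RV P >-> R}) : Prop :=
  forall (K : {fset I}) (A : I -> set R),
    [set` K] `<=` J -> (forall k, measurable (A k)) ->
    P (\bigcap_(k in [set` K]) (X k @^-1` A k)) =
    (\prod_(k <- K) P (X k @^-1` A k))%E.

(* All draws of a run on the queries [qs], as one family: the threshold noise
   [eta], then the [nu t i], then the [Z t i]. *)
Definition draws (eta : {RV P >-> R}) (nu Z : nat -> nat -> {RV P >-> R})
    (k : unit + (nat * nat + nat * nat)) : {RV P >-> R} :=
  match k with
  | inl _ => eta
  | inr (inl (t, i)) => nu t i
  | inr (inr (t, i)) => Z t i
  end.

Definition draw_indices (qs : seq (nat * nat)) :
    set (unit + (nat * nat + nat * nat)) :=
  [set k | match k with
           | inl _ => True
           | inr (inl q) | inr (inr q) => q \in qs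
           end].

(* Every [Z t i] is drawn in advance; [NATG] uses at most one of them. *)
Definition NATG_noise (xi : nat -> R) (qs : seq (nat * nat))
    (eta : {RV P >-> R}) (nu Z : nat -> nat -> {RV P >-> R}) : Prop :=
  [/\ laplace 2 eta,
      forall t i, (t, i) \in qs -> laplace (4 / xi t) (nu t i),
      forall t i, (t, i) \in qs -> laplace (8 / xi t) (Z t i) &
      mutually_independent (draw_indices qs) (draws eta nu Z)].

End probability.

(* Main.v *)
(** With scale [b], a Laplace variable has tail [P(x <= |X|) = exp(-x/b)].  Take
    as bad events [|eta| >= alpha xi_{t0} / 4], [|nu_{t,i}| >= alpha / 2] for
    some query, and [|Z| >= alpha] for the last query only; by the union bound
    they have total probability at most [beta].  Outside of them monotonicity
    of [xi] gives [|eta / xi_t| < alpha / 4] for every [t], so the combined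
    noise in each comparison is less than [3 alpha / 4]: all queries below
    [T - alpha] answer bottom, and the last one halts the run. *)

Require Import Defs.
From HB Require Import structures.
From mathcomp Require Import all_boot all_order all_algebra finmap.
From mathcomp Require Import all_classical all_reals all_analysis.
From mathcomp Require Import measurable_realfun.
From mathcomp Require Import lra.

Import Order.TTheory GRing.Theory Num.Theory.
Import numFieldNormedType.Exports.

Local Open Scope classical_set_scope.
Local Open Scope ring_scope.

(** * Finite union bound and measurability of simple events *)

Lemma measure_bigsetU_le (d : measure_display) (T : ringOfSetsType d)
    (R : realFieldType) (mu : {content set T -> \bar R}) (I : Type)
    (r : seq I) (F : I -> set T) :
  (forall i, measurable (F i)) ->
  (mu (\big[setU/set0]_(i <- r) F i) <= \sum_(i <- r) mu (F i))%E.
Proof.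
move=> mF; elim: r => [|i r IH]; first by rewrite !big_nil measure0.
rewrite !big_cons; apply: (le_trans (measureU2 _ _ _)) => //.
  exact: bigsetU_measurable.
exact: leeD2l.
Qed.

Lemma measurable_set_bool (d : measure_display) (T : measurableType d) (b : bool) :
  measurable [set _ : T | b].
Proof.
case: b; [rewrite (_ : mkset _ = setT)//|rewrite (_ : mkset _ = set0)//].
  by apply/seteqP; split.
by apply/seteqP; split.
Qed.

Lemma measurable_le (d : measure_display) (Om : measurableType d)
    (R : realType) (g h : Om -> R) :
  measurable_fun setT g -> measurable_fun setT h ->
  measurable [set w | g w <= h w].
Proof.
by move=> mg mh; rewrite -[X in measurable X]setTI; exact: measurable_fun_le.
Qed.

Lemma measurable_normr_le (d : measure_display) (Om : measurableType d)
    (R : realType) (g : Om -> R) (x : R) :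
  measurable_fun setT g -> measurable [set w | x <= `|g w|].
Proof.
move=> mg; apply: measurable_le => //.
by apply: measurableT_comp.
Qed.

(** * Tails of the Laplace distribution *)

Section laplace_tail.
Context {R : realType}.
Variable b : R.
Hypothesis b_gt0 : 0 < b.

Lemma laplace_pdf_ge0 z : 0 <= laplace_pdf b z.
Proof.
by rewrite /laplace_pdf mulr_ge0 ?expR_ge0// invr_ge0 mulr_ge0// ltW.
Qed.

Lemma continuous_laplace_pdf : continuous (laplace_pdf b).
Proof.
move=> z; apply: (@continuousM _ R^o (fun=> (2 * b)^-1)
  (fun z => expR (- (`|z| / b)))); first exact: cst_continuous.
apply: continuous_comp; last exact: continuous_expR.
apply: (@continuousN _ R^o); apply: (@continuousM _ R^o Num.norm (fun=> b^-1)).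
  exact: norm_continuous.
exact: cst_continuous.
Qed.

(** On a half-line of nonnegative reals the absolute value disappears, so the density has the
    antiderivative [- exp(-z/b) / 2], which vanishes at infinity. *)
Lemma integral_laplace_pdf_itvcy (x : R) : 0 <= x ->
  (\int[lebesgue_measure]_(z in `[x, +oo[) (laplace_pdf b z)%:E =
   (expR (- (x / b)) / 2)%:E)%E.
Proof.
move=> x0; pose F (z : R) : R := - (expR (- b^-1 * z) / 2).
have dF (z : R) : is_derive z 1 F (b^-1 / 2 * expR (- b^-1 * z)).
  have -> : b^-1 / 2 * expR (- b^-1 * z) =
      - (2^-1 *: (- b^-1 * expR (- b^-1 * z))).
    by rewrite /GRing.scale/=; lra.
  have -> : F = \- (2^-1 \*: (fun z : R => expR (- b^-1 * z))).
    by apply/funext => y; rewrite /F /= /GRing.scale/= mulrC.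
  apply: is_deriveN; apply: is_deriveZ.
  (* The chain rule yields the outer derivative times [- b^-1 * 1], the [1] being the derivative of
     the identity; the goal is brought to that shape. *)
  rewrite -[X in X * _](mulr1 (- b^-1)) mulrC.
  have dl : is_derive z 1 ( *%R (- b^-1)) (- b^-1 * 1) by exact: is_deriveZ.
  exact: (@is_derive1_comp _ expR ( *%R (- b^-1)) z _ _ _ dl).
have cF : continuous F.
  by move=> z; apply/differentiable_continuous/derivable1_diffP; exact: ex_derive.
rewrite (@ge0_continuous_FTC2y _ _ F _ 0).
- by rewrite /F EFinN oppeK add0e mulNr [b^-1 * x]mulrC.
- by move=> z _; exact: laplace_pdf_ge0.
- exact/continuous_subspaceT/continuous_laplace_pdf.
- rewrite -oppr0; apply: cvgN; rewrite -[0](mul0r 2^-1).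
  apply: cvgM; last exact: cvg_cst.
  rewrite (_ : (fun x => expR (- b^-1 * x)) =
               (fun z => expR (- z)) \o (fun z => b^-1 * z)); last first.
    by apply: eq_fun => y; rewrite mulNr.
  apply: (@cvg_comp _ _ _ _ _ _ (pinfty_nbhs R)); last exact: cvgr_expR.
  have bV_gt0 : 0 < b^-1 by rewrite invr_gt0.
  exact: gt0_cvgMry.
- by move=> z _; exact: ex_derive.
- by apply/cvg_at_right_filter; exact: cF.
- move=> z; rewrite in_itv/= andbT => xz.
  rewrite derive1E derive_val /laplace_pdf invfM ger0_norm; last first.
    by rewrite (le_trans x0)// ltW.
  by rewrite mulNr [2^-1 * _]mulrC [z / b]mulrC.
Qed.

(** The tail consists of two half-lines, disjoint because [x] is positive. The density is even, so
    the substitution [z -> -z] folds the negative one onto the other, and two equal halves add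
    up. *)
Lemma integral_laplace_pdf_tail (x : R) : 0 < x ->
  (\int[lebesgue_measure]_(z in [set z | (x <= `|z|)%R]) (laplace_pdf b z)%:E =
   (expR (- (x / b)))%:E)%E.
Proof.
move=> x0.
have -> : [set z : R | x <= `|z|] = `]-oo, - x] `|` `[x, +oo[.
  apply/seteqP; split => z /=; rewrite !in_itv/= andbT ler_normr lerNr.
    by case/orP; [right|left].
  by case=> ->; rewrite ?orbT.
have mpdf : measurable_fun setT (EFin \o laplace_pdf b).
  apply/measurable_EFinP; apply: continuous_measurable_fun.
  exact: continuous_laplace_pdf.
rewrite ge0_integral_setU//=; last 3 first.
- exact: measurable_funTS.
- by move=> z _; rewrite lee_fin laplace_pdf_ge0.
- apply/disj_setPS => z /=; rewrite !in_itv/= andbT => -[zx xz].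
  by move: (le_trans xz zx); lra.
rewrite ge0_integration_by_substitutionNy; last 2 first.
- exact/continuous_subspaceT/continuous_laplace_pdf.
- by move=> z _; exact: laplace_pdf_ge0.
under eq_integral do rewrite /= {1}/laplace_pdf normrN -/(laplace_pdf b _).
rewrite integral_laplace_pdf_itvcy ?ltW// -EFinD; congr EFin.
by lra.
Qed.

Lemma laplace_tail (d : measure_display) (Om : measurableType d)
    (P : probability Om R) (X : {RV P >-> R}) (x : R) :
  laplace b X -> 0 < x ->
  P [set w | x <= `|X w|] = (expR (- (x / b)))%:E.
Proof.
move=> lapX x0; rewrite -integral_laplace_pdf_tail// -lapX//.
exact: measurable_normr_le.
Qed.

End laplace_tail.

(** * Enumeration of the queries, with the last one split off *)

Lemma query_indices_rcons (t0 t' : nat) (ell : nat -> nat) :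
  (t0 <= t')%N -> (0 < ell t')%N ->
  exists s, query_indices t0 t' ell = rcons s (t', ell t') /\
    forall t i, (t, i) \in s ->
      [/\ (t0 <= t <= t')%N, (1 <= i <= ell t)%N & (t, i) <> (t', ell t')].
Proof.
move=> t0t' ell_gt0.
have iota_rcons m n : (m <= n)%N -> index_iota m n.+1 = rcons (index_iota m n) n.
  by move=> mn; rewrite /index_iota subSn// -addn1 iotaD subnKC// cats1.
(* An earlier query either has [t < t'] or has [t = t'] and [i < ell t']; each of the two blocks
   differs from the last index in the corresponding coordinate. *)
exists ([seq (t, i) | t <- index_iota t0 t', i <- index_iota 1 (ell t).+1] ++
        [seq (t', i) | i <- index_iota 1 (ell t')]); split.
  rewrite /query_indices iota_rcons// allpairs_rcons (iota_rcons 1%N)//.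
  by rewrite map_rcons rcons_cat.
move=> t i; rewrite mem_cat => /orP[/allpairsPdep[u [j []]]|/mapP[j]].
  rewrite !mem_index_iota ltnS => /andP[t0u ut'] jell [-> ->]; split => //.
    by rewrite t0u ltnW.
  by case=> uE _; rewrite uE ltnn in ut'.
rewrite mem_index_iota => /andP[j1 jell] [-> ->]; split.
- by rewrite t0t' leqnn.
- by rewrite j1 ltnW.
- by case=> jE; rewrite jE ltnn in jell.
Qed.

Lemma mem_query_indices (t0 t' : nat) (ell : nat -> nat) t i :
  ((t, i) \in query_indices t0 t' ell) =
  (t0 <= t <= t')%N && (1 <= i <= ell t)%N.
Proof.
apply/allpairsPdep/andP => [[u [j []]]|[tt' iell]].
  by rewrite !mem_index_iota !ltnS => ? ? [-> ->].
by exists t, i; rewrite !mem_index_iota !ltnS.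
Qed.

(** Turns the union bound over single queries into the weighted sum over [t] that bounds [beta]. *)
Lemma sum_query_indices (R : pzRingType) (t0 t' : nat) (ell : nat -> nat)
    (g : nat -> R) :
  \sum_(q <- query_indices t0 t' ell) g q.1 =
  \sum_(t0 <= t < t'.+1) (ell t)%:R * g t.
Proof.
rewrite big_allpairs_dep/=; apply: eq_bigr => t _.
by rewrite sumr_const_nat subn1 mulr_natl.
Qed.

(** * Shape and measurability of the transcript *)

Section transcript.
Context {R : realType} {U : finType}.
Variables (D : nat -> seq U) (f : nat -> nat -> seq U -> R) (T : R).
Variable xi : nat -> R.

Lemma NATG_rcons (eta : R) (nu Z : nat -> nat -> R) s t i :
  (forall u j, (u, j) \in s -> f u j (D u) + nu u j < T + eta / xi u) ->
  T + eta / xi t <= f t i (D t) + nu t i ->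
  NATG D f T xi eta nu Z (rcons s (t, i)) =
  rcons [seq (q, None) | q <- s] ((t, i), Some (f t i (D t) + Z t i)).
Proof.
move=> below above; elim: s below => [|[u j] s IH] below /=.
  by rewrite above.
rewrite leNgt below ?mem_head//= IH// => v k vks.
by apply: below; rewrite inE vks orbT.
Qed.

(** By induction on the queries, the event splits according to whether the current comparison halts
    the run. A bottom entry does not depend on the noise, so only numeric entries need a
    measurability assumption on [p]. *)
Lemma measurable_all_NATG (d : measure_display) (Om : measurableType d)
    (eta : Om -> R) (nu Z : nat -> nat -> Om -> R)
    (p : pred (nat * nat * option R)) qs :
  measurable_fun setT eta -> (forall t i, measurable_fun setT (nu t i)) ->
  (forall t i, measurable [set w | p ((t, i), Some (f t i (D t) + Z t i w))]) ->
  measurable [set w | all p (NATG D f T xi (eta w) (fun t i => nu t i w)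
                              (fun t i => Z t i w) qs)].
Proof.
move=> meta mnu mp; elim: qs => [|[t i] qs IH] /=.
  exact: (measurable_set_bool _ _ true).
pose A := [set w | T + eta w / xi t <= f t i (D t) + nu t i w].
have mA : measurable A.
  apply: measurable_le; apply: measurable_funD => //.
  exact: measurable_funM.
rewrite (_ : mkset _ =
    (A `&` [set w | p ((t, i), Some (f t i (D t) + Z t i w))]) `|`
    (~` A `&` ([set w | p ((t, i), None)] `&`
      [set w | all p (NATG D f T xi (eta w) (fun t i => nu t i w)
                         (fun t i => Z t i w) qs)]))).
  apply: measurableU; first exact: measurableI.
  apply: measurableI; first exact: measurableC.
  apply: measurableI => //.
  exact: measurable_set_bool.
apply/seteqP; split => w /=; rewrite /A /=.
  case: ifPn => Aw /=; first by rewrite andbT; left.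
  by move=> /andP[pw ?]; right; split => //; exact/negP.
case=> [[-> pw]|[/negP/negbTE -> [pw aw]]] /=; first by rewrite pw.
by rewrite pw aw.
Qed.

End transcript.

(** * Union bound over the bad events and accuracy outside of them *)

Theorem theorem35 (R : realType) (U : finType)
    (t0 t' : nat) (xi Delta : nat -> R) (alpha beta T : R)
    (D : nat -> seq U) (ell : nat -> nat) (f : nat -> nat -> seq U -> R)
    (d : measure_display) (Om : measurableType d) (P : probability Om R)
    (eta : {RV P >-> R}) (nu Z : nat -> nat -> {RV P >-> R}) :
  (forall t, (t0 <= t)%N -> 0 < xi t) ->
  (forall t, (t0 <= t)%N -> 0 < Delta t) ->
  (forall s t, (t0 <= s <= t)%N -> Delta t <= Delta s) ->
  (forall s t, (t0 <= s <= t)%N -> xi t * Delta t <= xi s * Delta s) ->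
  (forall s t, (t0 <= s <= t)%N -> xi s <= xi t) ->
  0 < alpha ->
  database_stream t0 D ->
  (t0 <= t')%N -> (0 < ell t')%N ->
  (forall t i, (t0 <= t <= t')%N -> (1 <= i <= ell t)%N ->
     sensitivity t (f t i) <= Delta t) ->
  (forall t i, (t0 <= t <= t')%N -> (1 <= i <= ell t)%N ->
     (t, i) <> (t', ell t') -> f t i (D t) < T - alpha) ->
  T + alpha <= f t' (ell t') (D t') ->
  \sum_(t0 <= t < t'.+1) (ell t)%:R * expR (- (alpha * xi t / 8))
    + expR (- (alpha * xi t0 / 8)) + expR (- (alpha * xi t' / 8)) <= beta ->
  NATG_noise xi (query_indices t0 t' ell) eta nu Z ->
  ((1 - beta)%:E <=
   P [set w | let a := NATG D f T xi (eta w) (fun t i => nu t i w)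
                         (fun t i => Z t i w) (query_indices t0 t' ell) in
       [/\ (t', ell t') \in unzip1 a,
           forall (t i : nat) (x : R), ((t, i), Some x) \in a ->
             `|f t i (D t) - x| <= alpha /\ T - alpha <= f t i (D t) &
           forall t i : nat, ((t, i), None) \in a ->
             f t i (D t) <= T + alpha]%R])%E.
Proof.
move=> xi_gt0 _ _ _ xi_mono alpha_gt0 _ t0t' ell_gt0 _ below above betaE.
case=> lap_eta lap_nu lap_Z _.
set E := [set w | _]; set qs := query_indices t0 t' ell.
have [s [qsE sP]] := query_indices_rcons t0 t' ell t0t' ell_gt0.
pose Beta := [set w | alpha * xi t0 / 4 <= `|eta w|].
pose BZ := [set w | alpha <= `|Z t' (ell t') w|].
pose Bnu (q : nat * nat) := [set w | alpha / 2 <= `|nu q.1 q.2 w|].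
pose Bad := (\big[setU/set0]_(q <- qs) Bnu q) `|` Beta `|` BZ.
have mBnu : measurable (\big[setU/set0]_(q <- qs) Bnu q).
  by apply: bigsetU_measurable => q _; exact: measurable_normr_le.
have mBeta : measurable Beta by exact: measurable_normr_le.
have mBZ : measurable BZ by exact: measurable_normr_le.
have mBad : measurable Bad by do 2 apply: measurableU => //.
have xit0 : 0 < xi t0 by exact: xi_gt0.
have xit' : 0 < xi t' by exact: xi_gt0.
have PU (A B : set Om) : measurable A -> measurable B ->
    (P (A `|` B) <= P A + P B)%E by exact: measureU2.
have PBnu : (P (\big[setU/set0]_(q <- qs) Bnu q) <= \sum_(q <- qs) P (Bnu q))%E.
  by apply: measure_bigsetU_le => q; exact: measurable_normr_le.
have PBad : (P Bad <= beta%:E)%E.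
  (* The events [BZ], [Beta] and the [Bnu q] are peeled off to match the summands from right to
     left. Threshold over scale always gives the factor 1/8: [alpha / (8 / xi t')],
     [(alpha * xi t0 / 4) / 2] and [(alpha / 2) / (4 / xi t)]. *)
  rewrite -lee_fin in betaE; apply: le_trans betaE.
  rewrite !EFinD; apply: (le_trans (PU _ _ _ _)) => //.
    exact: measurableU.
  apply: leeD; last first.
    rewrite /BZ (laplace_tail (8 / xi t')) ?divr_gt0//.
      by rewrite lee_fin invf_div mulrA.
    by apply: lap_Z; rewrite mem_query_indices t0t' leqnn ell_gt0 leqnn.
  apply: (le_trans (PU _ _ _ _)) => //.
  apply: leeD; last first.
    rewrite /Beta (laplace_tail 2)//; last by rewrite divr_gt0 ?mulr_gt0.
    by rewrite lee_fin ler_expR; lra.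
  apply: (le_trans PBnu).
  rewrite -(sum_query_indices _ t0 t' ell (fun t => expR (- (alpha * xi t / 8)))).
  (* Membership in [qs] is retained, since it supplies the law of [nu t i] and the positivity of
     [xi t]. *)
  rewrite -sumEFin big_seq [leRHS]big_seq; apply: lee_sum => -[t i] tiqs.
  have := tiqs; rewrite mem_query_indices => /andP[/andP[t0t _] _].
  have xit : 0 < xi t by exact: xi_gt0.
  rewrite /Bnu (laplace_tail (4 / xi t)) ?divr_gt0//; last exact: lap_nu.
  by rewrite lee_fin ler_expR invf_div/=; lra.
(* A boolean test of each entry replaces the quantification over all real answers, so that [E]
   becomes a combination of two [all] events on the transcript. *)
pose ok (x : nat * nat * option R) : bool :=
  let: ((t, i), a) := x in
  if a is Some y then (`|f t i (D t) - y| <= alpha) && (T - alpha <= f t i (D t))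
  else f t i (D t) <= T + alpha.
have mE : measurable E.
  pose a w := NATG D f T xi (eta w) (fun t i => nu t i w)
                (fun t i => Z t i w) qs.
  have -> : E = ~` [set w | all (fun x => x.1 != (t', ell t')) (a w)] `&`
                [set w | all ok (a w)].
    apply/seteqP; split => w; rewrite /E /= -/(a w).
      move=> [/mapP[x xa xE] okS okN]; split.
        by move=> /allP/(_ _ xa); rewrite -xE eqxx.
      by apply/allP => -[[t i] [y|]] /=; [move/okS => -[-> ->]|move/okN].
    move=> [/negP/allPn[x xa /negPn/eqP xE] /allP okw]; split.
    - by apply/mapP; exists x.
    - by move=> t i y /okw/andP.
    - by move=> t i /okw.
  apply: measurableI.
    apply: measurableC; apply: measurable_all_NATG => //.
    by move=> t i; exact: (measurable_set_bool _ _ ((t, i) != _)).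
  apply: measurable_all_NATG => // t i /=.
  (* This condition is constant in [w]; when it holds, the event reduces to [|Z t i| <= alpha]. *)
  case: (T - alpha <= _); last first.
    by under eq_set do rewrite andbF; exact: (measurable_set_bool _ _ false).
  under eq_set do rewrite andbT opprD addNKr normrN.
  by apply: measurable_le => //; exact: measurableT_comp.
have BadCE : ~` Bad `<=` E.
  move=> w /not_orP[/not_orP[nBnu /negP]]; rewrite -ltNge => eta_lt /negP.
  rewrite -ltNge => Z_lt.
  have nu_lt t i : (t, i) \in qs -> `|nu t i w| < alpha / 2.
    move=> tiqs; rewrite ltNge; apply/negP => nu_ge; apply: nBnu.
    by rewrite -bigcup_seq; exists (t, i).
  have eta_xi t : (t0 <= t)%N -> `|eta w / xi t| < alpha / 4.
    move=> t0t; have xit : 0 < xi t by exact: xi_gt0.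
    rewrite normrM [X in _ * X]gtr0_norm ?invr_gt0// ltr_pdivrMr//.
    apply: (lt_le_trans eta_lt).
    have : alpha * xi t0 <= alpha * xi t.
      by rewrite ler_pM2l// xi_mono// leqnn.
    by lra.
  have NATGE : NATG D f T xi (eta w) (fun t i => nu t i w) (fun t i => Z t i w) qs =
      rcons [seq (q, None) | q <- s]
        ((t', ell t'), Some (f t' (ell t') (D t') + Z t' (ell t') w)).
    (* Earlier queries have noisy value below [T - alpha / 2] and noisy threshold above
       [T - alpha / 4]; for the last query the signs are reversed. *)
    rewrite /qs qsE; apply: NATG_rcons => [t i tis|].
      have [tt' iell neq] := sP _ _ tis.
      have := below _ _ tt' iell neq.
      have := nu_lt t i; rewrite /qs qsE mem_rcons inE tis orbT => /(_ isT).
      have /eta_xi : (t0 <= t)%N by case/andP: tt'.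
      by rewrite !ltr_norml => /andP[? ?] /andP[? ?] ?; lra.
    have := nu_lt t' (ell t'); rewrite /qs qsE mem_rcons mem_head => /(_ isT).
    have := eta_xi _ t0t'.
    by rewrite !ltr_norml => /andP[? ?] /andP[? ?]; lra.
  (* The only numeric answer is the last one, with error [|Z| < alpha]; every bottom belongs to a
     query below [T - alpha]. *)
  rewrite /E /= -/qs NATGE; split.
  - by rewrite /unzip1 map_rcons mem_rcons mem_head.
  - move=> t i y; rewrite mem_rcons inE => /orP[/eqP[-> -> ->]|/mapP[]//].
    by rewrite opprD addNKr normrN; split; [exact: ltW|lra].
  - move=> t i; rewrite mem_rcons inE => /orP[/eqP//|/mapP[q qs' [qE]]].
    rewrite -qE in qs'; have [tt' iell neq] := sP _ _ qs'.
    by have := below _ _ tt' iell neq; lra.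
apply: (@le_trans _ _ (P (~` Bad))).
  by rewrite probability_setC// EFinB leeB.
by apply: le_measure => //; rewrite inE//; exact: measurableC.
Qed.
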